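(* Let $H$ be a complex Hilbert space and let $A,B\in\mathcal{B}(H)$ be accretive. Then $$\Re\big(\mathcal{S}(A|B)\big)\ \geq\ \mathcal{S}\big(\Re A\,|\,\Re B\big).$$
   Context: $\mathcal{B}(H)$ is the algebra of bounded linear operators on $H$. A self-adjoint $A\in\mathcal{B}(H)$ is positive if $\langle Ax,x\rangle\ge 0$ for all $x\in H$, and strictly positive if it is positive and invertible; for self-adjoint $X,Y$, $X\ge Y$ means $X-Y$ is positive. $\Re A=(A+A^* )/2$; $A\in\mathcal{B}(H)$ is accretive if $\Re A$ is strictly positive (then $A$ is invertible and $A^{-1}$ is accretive; sums and positive multiples of accretive operators are accretive). For accretive $A,B$ and $t\in(0,1)$, the $t$-weighted harmonic mean is $A!_tB:=\big((1-t)A^{-1}+tB^{-1}\big)^{-1}$, and the relative operator entropy of $A$ and $B$ is $$\mathcal{S}(A|B):=\int_0^1\frac{A!_tB-A}{t}\,dt$$ (integral in operator norm). When $A,B$ are strictly positive this equals $A^{1/2}\log(A^{-1/2}BA^{-1/2})A^{1/2}$. *)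

(* Defs.v *)
From Stdlib Require Import Reals Lra.
From Stdlib Require Import ProofIrrelevance FunctionalExtensionality.
From Stdlib Require Import PropExtensionality ClassicalEpsilon.
From Coquelicot Require Import Coquelicot.

Open Scope R_scope.

(** [inner] is linear in the first argument.  Positive definiteness follows
    from [inner_norm], which says that the norm of [H] is the one induced by
    [inner]. *)
Record HilbertSpace := {
  hilbert_space :> CompleteNormedModule C_AbsRing;
  inner : hilbert_space -> hilbert_space -> C;
  inner_plus_l : forall x y z, inner (plus x y) z = Cplus (inner x z) (inner y z);
  inner_scal_l : forall (k : C) x y, inner (scal k x) y = Cmult k (inner x y);
  inner_conj : forall x y, inner y x = Cconj (inner x y);
  inner_norm : forall x, inner x x = RtoC (norm x ^ 2)
}.

Arguments inner {h} _ _.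

Lemma minus_plus_plus {G : AbelianGroup} (a b p q : G) :
  minus (plus a b) (plus p q) = plus (minus a p) (minus b q).
Proof.
  unfold minus; rewrite opp_plus, <- !plus_assoc; f_equal.
  rewrite !plus_assoc; f_equal; apply plus_comm.
Qed.

Lemma plus_minus_minus {G : AbelianGroup} (a b c : G) :
  plus (minus a b) (plus (minus b c) c) = a.
Proof.
  unfold minus; rewrite <- !plus_assoc, (plus_opp_l c), plus_zero_r.
  now rewrite plus_opp_l, plus_zero_r.
Qed.

(** [is_linear] includes boundedness. *)
Record BOp (H : HilbertSpace) := mkBOp {
  bop_fun :> H -> H;
  bop_linear : is_linear bop_fun
}.

Arguments mkBOp {H} _ _.
Arguments bop_fun {H} _ _.
Arguments bop_linear {H} _.

Section BoundedOperators.

Context {H : HilbertSpace}.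

Lemma bop_ext (A B : BOp H) : (forall x, A x = B x) -> A = B.
Proof.
  destruct A as [f Hf], B as [g Hg]; simpl; intros E.
  assert (f = g) by (apply functional_extensionality; exact E).
  subst g; f_equal; apply proof_irrelevance.
Qed.

Lemma hnorm_triangle (x y : H) : norm (plus x y) <= norm x + norm y.
Proof. exact (@norm_triangle C_AbsRing H x y). Qed.

Lemma hnorm_scal (k : C) (x : H) : norm (scal k x) <= Cmod k * norm x.
Proof. exact (@norm_scal C_AbsRing H k x). Qed.

Lemma hnorm_zero : norm (@zero H) = 0.
Proof. exact (@norm_zero C_AbsRing H). Qed.

Lemma hnorm_opp (x : H) : norm (opp x) = norm x.
Proof. exact (@norm_opp C_AbsRing H x). Qed.

Lemma hnorm_scal_minus (k : C) (x y : H) :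
  norm (@minus H (scal k x) (scal k y)) <= Cmod k * norm (minus x y).
Proof.
  apply Rle_trans with (2 := hnorm_scal k (minus x y)); right; apply f_equal.
  symmetry; exact (@scal_minus_distr_l C_Ring H k x y).
Qed.

Lemma hminus_trans (y x z : H) :
  minus x z = plus (minus x y : H) (minus y z : H).
Proof. exact (@minus_trans H y x z). Qed.

Lemma bop_linear_plus (A : BOp H) (x y : H) : A (plus x y) = plus (A x) (A y).
Proof. exact (linear_plus _ (bop_linear A) x y). Qed.

Lemma bop_linear_scal (A : BOp H) (k : C) (x : H) : A (scal k x) = scal k (A x).
Proof. exact (linear_scal _ (bop_linear A) k x). Qed.

Lemma is_linear_add (f g : H -> H) :
  is_linear f -> is_linear g -> is_linear (fun x => plus (f x) (g x)).
Proof.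
  intros Hf Hg.
  exact (is_linear_comp _ _ (is_linear_prod _ _ Hf Hg) is_linear_plus).
Qed.

Lemma is_linear_neg (f : H -> H) :
  is_linear f -> is_linear (fun x => opp (f x)).
Proof. intros Hf; exact (is_linear_comp _ _ Hf is_linear_opp). Qed.

Lemma is_linear_scale (k : C) (f : H -> H) :
  is_linear f -> is_linear (fun x => scal k (f x)).
Proof.
  intros Hf.
  exact (is_linear_comp _ _ Hf (is_linear_scal_r k Cmult_comm)).
Qed.

Definition bop_plus (A B : BOp H) : BOp H :=
  mkBOp _ (is_linear_add A B (bop_linear A) (bop_linear B)).
Definition bop_opp (A : BOp H) : BOp H :=
  mkBOp _ (is_linear_neg A (bop_linear A)).
Definition bop_zero : BOp H := mkBOp _ (@is_linear_zero C_AbsRing H H).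
(** Only real scalars are made canonical: [RInt] needs a normed module over
    the reals. *)
Definition bop_scal (r : R) (A : BOp H) : BOp H :=
  mkBOp _ (is_linear_scale (RtoC r) A (bop_linear A)).

Definition bop_one : BOp H := mkBOp _ (@is_linear_id C_AbsRing H).
Definition bop_comp (A B : BOp H) : BOp H :=
  mkBOp _ (is_linear_comp B A (bop_linear B) (bop_linear A)).

(** Operator norm; the supremum is finite by [bop_norm_lub]. *)
Definition bop_norm (A : BOp H) : R :=
  real (Lub_Rbar (fun r => exists x : H, norm x <= 1 /\ r = norm (A x))).

End BoundedOperators.

Section BoundedOperatorStructure.

Variable H : HilbertSpace.

Definition BOp_AbelianMonoid_mixin : AbelianMonoid.mixin_of (BOp H).
Proof.
  apply (AbelianMonoid.Mixin _ bop_plus bop_zero); intros; apply bop_ext;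
    intros; simpl.
  - apply plus_comm.
  - apply plus_assoc.
  - apply plus_zero_r.
Defined.

Canonical BOp_AbelianMonoid :=
  AbelianMonoid.Pack (BOp H) BOp_AbelianMonoid_mixin (BOp H).

Definition BOp_AbelianGroup_mixin : AbelianGroup.mixin_of BOp_AbelianMonoid.
Proof.
  apply (AbelianGroup.Mixin _ bop_opp); intros A; apply bop_ext; intros x.
  apply (@plus_opp_r H).
Defined.

Definition BOp_AbelianGroup_class : AbelianGroup.class_of (BOp H) :=
  AbelianGroup.Class _ BOp_AbelianMonoid_mixin BOp_AbelianGroup_mixin.

Canonical BOp_AbelianGroup :=
  AbelianGroup.Pack (BOp H) BOp_AbelianGroup_class (BOp H).

Definition BOp_ModuleSpace_mixin : ModuleSpace.mixin_of R_Ring BOp_AbelianGroup.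
Proof.
  apply (ModuleSpace.Mixin R_Ring BOp_AbelianGroup bop_scal).
  - intros r s A; apply bop_ext; intros x; simpl.
    rewrite scal_assoc; f_equal.
    change (Cmult (RtoC r) (RtoC s) = RtoC (r * s)).
    now rewrite RtoC_mult.
  - intros A; apply bop_ext; intros x; simpl.
    apply (@scal_one C_Ring).
  - intros r A B; apply bop_ext; intros x; simpl.
    apply (@scal_distr_l C_Ring).
  - intros r s A; apply bop_ext; intros x; simpl.
    change (RtoC (plus r s)) with (RtoC (r + s)); rewrite RtoC_plus.
    exact (@scal_distr_r C_Ring _ (RtoC r) (RtoC s) (A x)).
Defined.

Definition BOp_ModuleSpace_class : ModuleSpace.class_of R_Ring (BOp H) :=
  ModuleSpace.Class R_Ring _ BOp_AbelianGroup_class BOp_ModuleSpace_mixin.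

Canonical BOp_ModuleSpace :=
  ModuleSpace.Pack R_Ring (BOp H) BOp_ModuleSpace_class (BOp H).

Lemma bop_plusE (A B : BOp H) x : plus A B x = plus (A x) (B x).
Proof. reflexivity. Qed.

Lemma bop_minusE (A B : BOp H) x : minus A B x = minus (A x) (B x).
Proof. reflexivity. Qed.

Lemma bop_scalE (r : R) (A : BOp H) x : scal r A x = scal (RtoC r) (A x).
Proof. reflexivity. Qed.

Lemma bop_norm_ge_0_finite (A : BOp H) (M : R) :
  0 <= M -> (forall x : H, norm (A x) <= M * norm x) ->
  0 <= bop_norm A <= M /\
  is_lub_Rbar (fun r => exists x : H, norm x <= 1 /\ r = norm (A x)) (bop_norm A).
Proof.
  intros HM HA; unfold bop_norm.
  set (E := fun r => exists x : H, norm x <= 1 /\ r = norm (A x)).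
  pose proof (Lub_Rbar_correct E) as HL.
  assert (E0 : E 0).
  { pose proof (@hnorm_zero H) as hz.
    exists (@zero H); split.
    - apply Rle_trans with (1 := Req_le _ _ hz); lra.
    - exact (eq_sym (eq_trans (f_equal norm (linear_zero _ (bop_linear A))) hz)). }
  assert (HU : Rbar_le (Lub_Rbar E) M).
  { apply (proj2 HL); intros r (x & Hx & ->); simpl.
    apply Rle_trans with (1 := HA x).
    rewrite <- (Rmult_1_r M) at 2; now apply Rmult_le_compat_l. }
  pose proof (proj1 HL 0 E0) as H0.
  destruct (Lub_Rbar E) as [l| |]; simpl in *; tauto.
Qed.

Lemma bop_norm_le (A : BOp H) (M : R) :
  0 <= M -> (forall x : H, norm (A x) <= M * norm x) -> bop_norm A <= M.
Proof. intros HM HA; now destruct (bop_norm_ge_0_finite A M HM HA) as [[_ h] _]. Qed.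

Lemma bop_norm_lub (A : BOp H) :
  0 <= bop_norm A /\
  is_lub_Rbar (fun r => exists x : H, norm x <= 1 /\ r = norm (A x)) (bop_norm A).
Proof.
  destruct (linear_norm _ (bop_linear A)) as (M & HM & HA).
  destruct (bop_norm_ge_0_finite A M (Rlt_le _ _ HM) HA) as [[h _] h'].
  now split.
Qed.

Lemma norm_bop_le (A : BOp H) (x : H) : norm (A x) <= bop_norm A * norm x.
Proof.
  destruct (Req_dec (norm x) 0) as [E|E].
  { rewrite (norm_eq_zero _ E), (linear_zero _ (bop_linear A)), norm_zero; lra. }
  assert (P : 0 < norm x) by (pose proof (norm_ge_0 x); lra).
  destruct (bop_norm_lub A) as [_ [HU _]].
  set (y := scal (RtoC (/ norm x)) x : H).
  assert (Hy : norm y <= 1).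
  { apply Rle_trans with (1 := hnorm_scal (RtoC (/ norm x)) x).
    rewrite Cmod_R, Rabs_pos_eq.
    - right; field; exact E.
    - now apply Rlt_le, Rinv_0_lt_compat. }
  assert (Hx : x = scal (RtoC (norm x)) y).
  { unfold y; rewrite scal_assoc.
    replace (mult (RtoC (norm x)) (RtoC (/ norm x))) with (@one C_Ring).
    - symmetry; apply (@scal_one C_Ring).
    - change (RtoC 1 = Cmult (RtoC (norm x)) (RtoC (/ norm x))).
      rewrite <- RtoC_mult; f_equal; field; exact E. }
  assert (HAy : norm (A y) <= bop_norm A) by (apply (HU (norm (A y))); now exists y).
  rewrite Hx at 1; rewrite bop_linear_scal.
  apply Rle_trans with (1 := hnorm_scal _ _).
  rewrite Cmod_R, Rabs_pos_eq by now apply Rlt_le.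
  rewrite Rmult_comm; apply Rmult_le_compat_r; lra.
Qed.

Lemma bop_norm_triangle (A B : BOp H) :
  bop_norm (plus A B) <= bop_norm A + bop_norm B.
Proof.
  pose proof (proj1 (bop_norm_lub A)); pose proof (proj1 (bop_norm_lub B)).
  apply bop_norm_le; [lra|intros x].
  rewrite bop_plusE; apply Rle_trans with (1 := hnorm_triangle _ _).
  pose proof (norm_bop_le A x); pose proof (norm_bop_le B x); lra.
Qed.

Lemma bop_norm_scal (r : R) (A : BOp H) :
  bop_norm (scal r A) <= Rabs r * bop_norm A.
Proof.
  pose proof (proj1 (bop_norm_lub A)); pose proof (Rabs_pos r).
  apply bop_norm_le; [now apply Rmult_le_pos|intros x].
  rewrite bop_scalE; apply Rle_trans with (1 := hnorm_scal _ _).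
  rewrite Cmod_R, Rmult_assoc.
  apply Rmult_le_compat_l; [assumption|apply norm_bop_le].
Qed.

Lemma bop_norm_eq_0 (A : BOp H) : bop_norm A = 0 -> A = zero.
Proof.
  intros E; apply bop_ext; intros x; apply norm_eq_zero.
  pose proof (norm_bop_le A x) as h; rewrite E in h.
  pose proof (norm_ge_0 (A x)); lra.
Qed.

Lemma bop_norm_opp (A : BOp H) : bop_norm (opp A) <= bop_norm A.
Proof.
  apply bop_norm_le; [exact (proj1 (bop_norm_lub A))|intros x].
  change (norm (opp (A x)) <= bop_norm A * norm x).
  rewrite hnorm_opp; apply norm_bop_le.
Qed.

Definition bop_ball (A : BOp H) (e : R) (B : BOp H) : Prop :=
  bop_norm (minus B A) < e.

Definition BOp_UniformSpace_mixin : UniformSpace.mixin_of (BOp H).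
Proof.
  apply (UniformSpace.Mixin _ zero bop_ball); unfold bop_ball.
  - intros A e; rewrite minus_eq_zero.
    apply Rle_lt_trans with 0; [|apply cond_pos].
    apply bop_norm_le; [lra|intros x].
    change (norm (@zero H) <= 0 * norm x); rewrite hnorm_zero; lra.
  - intros A B e h; rewrite <- opp_minus.
    now apply Rle_lt_trans with (1 := bop_norm_opp _).
  - intros A B D e1 e2 h1 h2; rewrite (minus_trans B).
    apply Rle_lt_trans with (1 := bop_norm_triangle _ _); lra.
Defined.

Canonical BOp_UniformSpace :=
  UniformSpace.Pack (BOp H) BOp_UniformSpace_mixin (BOp H).

Canonical BOp_NormedModuleAux :=
  NormedModuleAux.Pack R_AbsRing (BOp H)
    (NormedModuleAux.Class R_AbsRing _ BOp_ModuleSpace_class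
       BOp_UniformSpace_mixin) (BOp H).

Definition BOp_NormedModule_mixin :
  NormedModule.mixin_of R_AbsRing BOp_NormedModuleAux.
Proof.
  apply (NormedModule.Mixin R_AbsRing BOp_NormedModuleAux bop_norm 1).
  - exact bop_norm_triangle.
  - exact bop_norm_scal.
  - intros A B e h; exact h.
  - intros A B e h; rewrite Rmult_1_l; exact h.
  - exact bop_norm_eq_0.
Defined.

Definition BOp_NormedModule_class : NormedModule.class_of R_AbsRing (BOp H) :=
  NormedModule.Class R_AbsRing _ _ BOp_NormedModule_mixin.

Canonical BOp_NormedModule :=
  NormedModule.Pack R_AbsRing (BOp H) BOp_NormedModule_class (BOp H).

Lemma eq_of_norm_minus_lt (x y : H) :
  (forall d, 0 < d -> norm (minus x y) < d) -> x = y.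
Proof.
  intros h.
  assert (E : norm (minus x y) = 0).
  { destruct (Req_dec (norm (minus x y)) 0) as [E|E]; [exact E|].
    pose proof (norm_ge_0 (minus x y)).
    specialize (h (norm (minus x y))); lra. }
  apply norm_eq_zero in E.
  apply (plus_reg_r (opp y)); rewrite plus_opp_r; exact E.
Qed.

Lemma bop_complete (F : (BOp H -> Prop) -> Prop) :
  ProperFilter F -> cauchy F ->
  exists L : BOp H, forall eps : posreal, F (ball L eps).
Proof.
  intros FF CF.
  assert (Fin : forall e : R, 0 < e ->
    exists A : BOp H, F (fun B => bop_norm (minus B A) < e)).
  { intros e he; exact (CF (mkposreal e he)). }
  assert (FN : Filter F) by apply FF.
  set (G := fun x : H => filtermap (fun A : BOp H => A x) F).
  assert (PG : forall x, ProperFilter (G x)).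
  { intros x; now apply filtermap_proper_filter. }
  assert (CG : forall x, cauchy (G x)).
  { intros x e.
    assert (p : 0 < norm x + 1) by (pose proof (norm_ge_0 x); lra).
    destruct (Fin (e / (norm x + 1))) as [A HA].
    { apply Rdiv_lt_0_compat; [apply cond_pos|exact p]. }
    exists (A x); unfold G, filtermap.
    apply filter_imp with (2 := HA); intros B hB.
    apply (@norm_compat1 C_AbsRing H); rewrite <- bop_minusE.
    apply Rle_lt_trans with (1 := norm_bop_le _ _).
    apply Rle_lt_trans with (e / (norm x + 1) * norm x).
    - apply Rmult_le_compat_r; [apply norm_ge_0|lra].
    - apply Rlt_le_trans with (e / (norm x + 1) * (norm x + 1)).
      + apply Rmult_lt_compat_l; [|lra].
        apply Rdiv_lt_0_compat; [apply cond_pos|exact p].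
      + right; field; lra. }
  set (L := fun x : H => lim (G x) : H).
  assert (HL : forall x d, 0 < d -> F (fun A => norm (minus (A x) (L x)) < d)).
  { intros x d hd.
    pose proof (@norm_factor_gt_0 C_AbsRing H) as nf.
    assert (hd' : 0 < d / @norm_factor C_AbsRing H) by now apply Rdiv_lt_0_compat.
    pose proof (complete_cauchy (G x) (PG x) (CG x) (mkposreal _ hd')) as h.
    unfold G at 1, filtermap in h.
    apply filter_imp with (2 := h); intros A hA.
    apply (@norm_compat2 C_AbsRing H) in hA; simpl in hA.
    replace d with (@norm_factor C_AbsRing H * (d / @norm_factor C_AbsRing H)) by (field; lra).
    exact hA. }
  assert (sym : forall x y : H, norm (minus x y) = norm (minus y x)).
  { intros x y; now rewrite <- opp_minus, hnorm_opp. }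
  assert (LP : forall x y : H, L (plus x y) = plus (L x) (L y)).
  { intros x y; apply eq_of_norm_minus_lt; intros d hd.
    assert (hd3 : 0 < d / 3) by lra.
    destruct (filter_ex _ (filter_and _ _ (HL (plus x y) _ hd3)
      (filter_and _ _ (HL x _ hd3) (HL y _ hd3)))) as (A & h1 & h2 & h3).
    rewrite sym in h1; rewrite bop_linear_plus in h1.
    rewrite (hminus_trans (plus (A x) (A y))).
    replace (minus (plus (A x) (A y)) (plus (L x) (L y)))
      with (plus (minus (A x) (L x) : H) (minus (A y) (L y) : H)).
    + apply Rle_lt_trans with (1 := hnorm_triangle _ _).
      pose proof (hnorm_triangle (minus (A x) (L x) : H) (minus (A y) (L y) : H)); lra.
    + symmetry; exact (minus_plus_plus (A x) (A y) (L x) (L y)). }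
  assert (LS : forall (k : C) (x : H), L (scal k x) = scal k (L x)).
  { intros k x; apply eq_of_norm_minus_lt; intros d hd.
    pose proof (Cmod_ge_0 k) as hk.
    assert (hd2 : 0 < d / 2) by lra.
    assert (hd3 : 0 < d / 2 / (Cmod k + 1)) by (apply Rdiv_lt_0_compat; lra).
    destruct (filter_ex _ (filter_and _ _ (HL (scal k x) _ hd2) (HL x _ hd3)))
      as (A & h1 & h2).
    rewrite sym in h1; rewrite bop_linear_scal in h1.
    rewrite (hminus_trans (scal k (A x))).
    apply Rle_lt_trans with (1 := hnorm_triangle _ _).
    pose proof (hnorm_scal_minus k (A x) (L x)) as h3.
    assert (Cmod k * norm (minus (A x) (L x)) <= d / 2).
    { apply Rle_trans with ((Cmod k + 1) * (d / 2 / (Cmod k + 1))).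
      - apply Rmult_le_compat; try lra; apply norm_ge_0.
      - right; field; lra. }
    lra. }
  assert (LB : exists M : R, 0 < M /\ forall x : H, norm (L x) <= M * norm x).
  { destruct (Fin 1 Rlt_0_1) as [A HA].
    pose proof (proj1 (bop_norm_lub A)) as nA.
    exists (bop_norm A + 1); split; [lra|intros x].
    apply le_epsilon; intros d hd.
    destruct (filter_ex _ (filter_and _ _ HA (HL x _ hd))) as (B & h1 & h2).
    rewrite sym in h2.
    assert (h3 : norm (minus (B x) (A x)) <= 1 * norm x).
    { rewrite <- bop_minusE; apply Rle_trans with (1 := norm_bop_le _ _).
      apply Rmult_le_compat_r; [apply norm_ge_0|lra]. }
    pose proof (norm_bop_le A x) as h4.
    replace (L x) with (plus (minus (L x) (B x) : H) (plus (minus (B x) (A x) : H) (A x))).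
    + apply Rle_trans with (1 := hnorm_triangle _ _).
      pose proof (hnorm_triangle (minus (B x) (A x) : H) (A x)); lra.
    + exact (plus_minus_minus (L x) (B x) (A x)). }
  exists (mkBOp L (Build_is_linear L LP LS LB)); intros e.
  assert (he : 0 < e / 4) by (pose proof (cond_pos e); lra).
  destruct (Fin _ he) as [A HA].
  apply filter_imp with (2 := HA); intros B hB.
  change (bop_norm (minus B (mkBOp L (Build_is_linear L LP LS LB))) < e).
  apply Rle_lt_trans with (e / 2); [|lra].
  apply bop_norm_le; [lra|intros x].
  apply le_epsilon; intros d hd.
  destruct (filter_ex _ (filter_and _ _ HA (HL x _ hd))) as (D & h1 & h2).
  rewrite bop_minusE; change (mkBOp L (Build_is_linear L LP LS LB) x) with (L x).
  rewrite (hminus_trans (D x)).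
  apply Rle_trans with (1 := hnorm_triangle _ _).
  rewrite (hminus_trans (A x) (B x) (D x)).
  pose proof (hnorm_triangle (minus (B x) (A x) : H) (minus (A x) (D x) : H)) as h3.
  assert (h4 : norm (minus (B x) (A x)) <= e / 4 * norm x).
  { rewrite <- bop_minusE; apply Rle_trans with (1 := norm_bop_le _ _).
    apply Rmult_le_compat_r; [apply norm_ge_0|lra]. }
  assert (h5 : norm (minus (A x) (D x)) <= e / 4 * norm x).
  { rewrite sym, <- bop_minusE; apply Rle_trans with (1 := norm_bop_le _ _).
    apply Rmult_le_compat_r; [apply norm_ge_0|lra]. }
  lra.
Qed.

Definition bop_lim (F : (BOp H -> Prop) -> Prop) : BOp H :=
  epsilon (inhabits zero) (fun L : BOp H => forall eps : posreal, F (ball L eps)).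

Definition BOp_CompleteSpace_mixin : CompleteSpace.mixin_of BOp_UniformSpace.
Proof.
  apply (CompleteSpace.Mixin BOp_UniformSpace bop_lim).
  - intros F PF CF.
    exact (epsilon_spec (inhabits zero)
      (fun L : BOp H => forall eps : posreal, F (ball L eps))
      (bop_complete F PF CF)).
  - intros F1 F2 h1 h2.
    assert (E : F1 = F2).
    { apply functional_extensionality; intros P.
      apply propositional_extensionality; split; [apply h2|apply h1]. }
    rewrite E; apply close_refl.
Defined.

Canonical BOp_CompleteSpace :=
  CompleteSpace.Pack (BOp H)
    (CompleteSpace.Class _ _ BOp_CompleteSpace_mixin) (BOp H).

Canonical BOp_CompleteNormedModule :=
  CompleteNormedModule.Pack R_AbsRing (BOp H)
    (CompleteNormedModule.Class R_AbsRing _ BOp_NormedModule_class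
       BOp_CompleteSpace_mixin) (BOp H).

End BoundedOperatorStructure.

Section OperatorEntropy.

Context {H : HilbertSpace}.

Definition is_adjoint (A A' : BOp H) : Prop :=
  forall x y : H, inner (A x) y = inner x (A' y).

(** Exactly one operator is an adjoint of [A] (Riesz), so the value is the
    usual adjoint. *)
Definition adjoint (A : BOp H) : BOp H :=
  epsilon (inhabits zero) (is_adjoint A).

Definition is_inverse (A B : BOp H) : Prop :=
  bop_comp A B = bop_one /\ bop_comp B A = bop_one.

Definition invertible (A : BOp H) : Prop := exists B : BOp H, is_inverse A B.

(** The inverse of [A] when [A] is invertible, unspecified otherwise. *)
Definition bop_inv (A : BOp H) : BOp H :=
  epsilon (inhabits zero) (is_inverse A).

Definition self_adjoint (A : BOp H) : Prop := adjoint A = A.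

(** For self-adjoint [A], [inner (A x) x] is real. *)
Definition positive (A : BOp H) : Prop :=
  self_adjoint A /\ forall x : H, 0 <= Re (inner (A x) x).

Definition strictly_positive (A : BOp H) : Prop :=
  positive A /\ invertible A.

Definition bop_ge (X Y : BOp H) : Prop := positive (minus X Y).

Definition real_part (A : BOp H) : BOp H :=
  scal (1 / 2) (plus A (adjoint A)).

Definition accretive (A : BOp H) : Prop := strictly_positive (real_part A).

Definition harmonic_mean (t : R) (A B : BOp H) : BOp H :=
  bop_inv (plus (scal (1 - t) (bop_inv A)) (scal t (bop_inv B))).

(** Riemann integral in the operator norm.  For accretive [A] and [B] the
    integrand is continuous on (0, 1] and has a limit at 0; its value at the
    single point 0 does not affect [RInt]. *)
Definition rel_entropy (A B : BOp H) : BOp H :=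
  RInt (fun t : R => scal (/ t) (minus (harmonic_mean t A B) A)) 0 1.

End OperatorEntropy.

(* Main.v *)
From Stdlib Require Import Reals Lra Psatz Classical ClassicalEpsilon.
From Coquelicot Require Import Coquelicot.
Require Import Defs.

(** The inequality holds already under the integral sign, because
    [Re <(A !_t B) x, x>] dominates [<(Re A !_t Re B) x, x>]
    ([re_inner_harmonic_mean_ge]).  To see this put [v = (A !_t B) x],
    [y = A^-1 v] and [z = B^-1 v].  Then [x = (1 - t) y + t z], and pairing
    with [v = A y = B z] gives
    [Re <v, x> = (1 - t) Re <A y, y> + t Re <B z, z>]
    ([harmonic_mean_form]).  The right-hand side involves only the real parts
    of [A] and [B].  For positive operators the harmonic mean is the minimum
    of this energy over all splittings of [x] ([harmonic_mean_minimal]), so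
    the splitting found for [A] and [B] bounds the harmonic mean of the real
    parts from above.  Subtracting [Re <A x, x>] on both sides and dividing by
    [t > 0] compares the two integrands.

    The rest is analysis.  Accretive operators are exactly those with a
    lower bound [Re <T x, x> >= c * norm x ^ 2]
    ([strictly_positive_coercive] gives one direction); by minimizing quadratic
    functionals ([variational_solution]) such operators are invertible, and
    the same minimization yields the Riesz theorem and hence adjoints
    ([adjoint_correct]).  The singular factor [1 / t] cancels algebraically
    ([entropy_integrand_regular]) and leaves a Lipschitz integrand, so the
    entropy is a genuine integral, and bounded functionals such as
    [T |-> Re <T x, y>] commute with it ([is_RInt_linear]).  Applied with
    [y = x] this gives positivity of the difference, and with general [x] and
    [y] it gives its self-adjointness. *)

Open Scope R_scope.

(** The discriminant of a nonnegative real quadratic; the linear case [c = 0]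
    is included because the forms below need only be semidefinite. *)
Lemma sqr_le_of_quadratic_ge_0 (a b c : R) :
  (forall s : R, 0 <= a + 2 * s * b + s ^ 2 * c) -> b ^ 2 <= a * c.
Proof.
  intros h.
  assert (hc : 0 <= c).
  { destruct (Rle_lt_dec 0 c) as [hc|hc]; [exact hc|exfalso].
    pose proof (h 0) as h0.
    (* For [c < 0] this argument is large enough that the quadratic term
       outweighs the other two. *)
    pose proof (h ((a + 1 + 2 * Rabs b) / - c + 1)) as h1.
    set (s := (a + 1 + 2 * Rabs b) / - c + 1) in *.
    assert (E : s * - c = a + 1 + 2 * Rabs b - c) by (unfold s; field; lra).
    pose proof (Rabs_pos b); pose proof (Rle_abs b).
    assert (1 <= s).
    { apply Rmult_le_reg_r with (- c); lra. }
    nra. }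
  destruct (Req_dec c 0) as [->|hn].
  - destruct (Req_dec b 0) as [->|hb]; [lra|].
    (* Here the affine function takes the value -1. *)
    pose proof (h (- (a + 1) / (2 * b))) as h1.
    replace (a + 2 * (- (a + 1) / (2 * b)) * b + (- (a + 1) / (2 * b)) ^ 2 * 0)
      with (-1) in h1 by (field; exact hb).
    lra.
  - (* The minimum of the quadratic. *)
    pose proof (h (- b / c)) as h1.
    replace (a + 2 * (- b / c) * b + (- b / c) ^ 2 * c)
      with ((a * c - b ^ 2) / c) in h1 by (field; exact hn).
    assert (0 <= a * c - b ^ 2); [|lra].
    replace (a * c - b ^ 2) with ((a * c - b ^ 2) / c * c) by (field; exact hn).
    now apply Rmult_le_pos.
Qed.

(** * The real inner product *)

Section RealInnerProduct.

Context {H : HilbertSpace}.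

(** Inequalities between operators see only the real part of [inner], so the
    argument runs in the real Hilbert space underlying [H]; complex linearity
    recovers the imaginary part where adjoints need it ([inner_of_re_inner]). *)
Definition re_inner (x y : H) : R := Re (inner x y).

Lemma re_inner_plus_l (x y z : H) :
  re_inner (plus x y) z = re_inner x z + re_inner y z.
Proof. unfold re_inner; now rewrite inner_plus_l. Qed.

Lemma re_inner_scal_l (k : R) (x y : H) :
  re_inner (scal (RtoC k) x) y = k * re_inner x y.
Proof. unfold re_inner; rewrite inner_scal_l; unfold Re, Cmult, RtoC; simpl; ring. Qed.

Lemma re_inner_sym (x y : H) : re_inner x y = re_inner y x.
Proof. unfold re_inner; now rewrite inner_conj. Qed.

Lemma re_inner_plus_r (x y z : H) :
  re_inner x (plus y z) = re_inner x y + re_inner x z.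
Proof. rewrite !(re_inner_sym x); apply re_inner_plus_l. Qed.

Lemma re_inner_scal_r (k : R) (x y : H) :
  re_inner x (scal (RtoC k) y) = k * re_inner x y.
Proof. rewrite !(re_inner_sym x); apply re_inner_scal_l. Qed.

Lemma re_inner_zero_l (x : H) : re_inner (@zero H) x = 0.
Proof.
  pose proof (re_inner_plus_l zero zero x) as h.
  rewrite (@plus_zero_l H) in h; lra.
Qed.

Lemma re_inner_opp_l (x y : H) : re_inner (@opp H x) y = - re_inner x y.
Proof.
  pose proof (re_inner_plus_l x (@opp H x) y) as h.
  rewrite (@plus_opp_r H), re_inner_zero_l in h; lra.
Qed.

Lemma re_inner_minus_l (x y z : H) :
  re_inner (@minus H x y) z = re_inner x z - re_inner y z.
Proof.
  change (re_inner (plus x (opp y : H)) z = re_inner x z - re_inner y z).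
  rewrite re_inner_plus_l, re_inner_opp_l; ring.
Qed.

Lemma re_inner_minus_r (x y z : H) :
  re_inner x (@minus H y z) = re_inner x y - re_inner x z.
Proof. rewrite !(re_inner_sym x); apply re_inner_minus_l. Qed.

Lemma re_inner_self (x : H) : re_inner x x = norm x ^ 2.
Proof. unfold re_inner; now rewrite inner_norm. Qed.

Lemma re_inner_ext (x y : H) : (forall z, re_inner x z = re_inner y z) -> x = y.
Proof.
  intros h; apply eq_of_norm_minus_lt; intros d hd.
  enough (norm (@minus H x y) ^ 2 = 0) by nra.
  rewrite <- re_inner_self, re_inner_minus_l, h; ring.
Qed.

(** Self-adjointness without the operator [adjoint], so that it can be used
    before adjoints are known to exist and checked by computation. *)
Definition symmetric (T : BOp H) : Prop :=
  forall x y : H, re_inner (T x) y = re_inner x (T y).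

Lemma bop_linear_minus (T : BOp H) (x y : H) : T (minus x y) = minus (T x) (T y).
Proof.
  change (T (plus x (opp y : H)) = plus (T x) (opp (T y) : H)).
  rewrite bop_linear_plus; f_equal.
  exact (linear_opp _ y (bop_linear T)).
Qed.

End RealInnerProduct.

Global Hint Rewrite @bop_linear_plus @bop_linear_scal @bop_linear_minus
  @re_inner_plus_l @re_inner_plus_r
  @re_inner_scal_l @re_inner_scal_r @re_inner_minus_l @re_inner_minus_r
  : re_inner.

(** * Coercive operators and quadratic minimization *)

Section Variational.

Context {H : HilbertSpace}.

Lemma symmetric_cauchy_schwarz (T : BOp H) (x y : H) :
  symmetric T -> (forall z : H, 0 <= re_inner (T z) z) ->
  re_inner (T x) y ^ 2 <= re_inner (T x) x * re_inner (T y) y.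
Proof.
  intros hT hp; apply sqr_le_of_quadratic_ge_0; intros s.
  pose proof (hp (plus x (scal (RtoC s) y))) as h.
  autorewrite with re_inner in h.
  rewrite (hT y x), (re_inner_sym y (T x)) in h; lra.
Qed.

Lemma re_inner_le_norm (x y : H) : Rabs (re_inner x y) <= norm x * norm y.
Proof.
  pose proof (norm_ge_0 x) as hx; pose proof (norm_ge_0 y) as hy.
  rewrite <- (Rabs_pos_eq (norm x * norm y)) by now apply Rmult_le_pos.
  apply Rsqr_le_abs_0; rewrite !Rsqr_pow2, Rpow_mult_distr, <- !re_inner_self.
  apply (symmetric_cauchy_schwarz bop_one).
  - intros u v; reflexivity.
  - intros z; simpl; rewrite re_inner_self; apply pow2_ge_0.
Qed.

(** The constant is explicit because integrability of the entropy needs one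
    lower bound valid for a whole family of operators. *)
Definition coercive (c : R) (T : BOp H) : Prop :=
  0 < c /\ forall x : H, c * norm x ^ 2 <= re_inner (T x) x.

(** The solution minimizes [J x = <T x, x> - 2 f x], which coercivity bounds
    below.  The sublevel sets of [J] close to its infimum generate a Cauchy
    filter, since the parallelogram identity bounds the distance of two
    almost minimizers by the excess of [J] over its infimum.  At an almost
    minimizer the first variation [<T y, z> - f z] is small by the
    discriminant inequality along the line [y + s z], so it vanishes at the
    limit.  Taking [T] the identity gives the Riesz representation theorem,
    and taking [T = S S*] the solvability of [S x = y]. *)
Lemma variational_solution (T : BOp H) (c : R) (f : H -> R) (K : R) :
  symmetric T -> coercive c T ->
  (forall x y, f (plus x y) = f x + f y) ->
  (forall (k : R) x, f (scal (RtoC k) x) = k * f x) ->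
  (forall x, Rabs (f x) <= K * norm x) ->
  exists x : H, forall z : H, re_inner (T x) z = f z.
Proof.
  intros hs [hc hT] fp fs fK.
  set (J := fun x : H => re_inner (T x) x - 2 * f x).
  assert (hJ : forall x, - J x <= K ^ 2 / c).
  { intros x; unfold J.
    pose proof (hT x) as h1; pose proof (fK x) as h2.
    pose proof (Rle_abs (f x)) as h3.
    assert (0 <= (c * norm x - K) ^ 2 / c).
    { apply Rdiv_le_0_compat; [apply pow2_ge_0|exact hc]. }
    (* Completing the square in [norm x] gives the lower bound. *)
    replace ((c * norm x - K) ^ 2 / c)
      with (c * norm x ^ 2 - 2 * K * norm x + K ^ 2 / c) in * by (field; lra).
    lra. }
  destruct (completeness (fun r => exists x, r = - J x)) as [m [hm1 hm2]].
  { exists (K ^ 2 / c); intros r [x ->]; apply hJ. }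
  { now exists (- J zero), zero. }
  assert (hlow : forall x, - m <= J x).
  { intros x; enough (- J x <= m) by lra; apply hm1; now exists x. }
  assert (happ : forall e, 0 < e -> exists x, J x < - m + e).
  { intros e he; apply NNPP; intros hn.
    enough (m <= m - e) by lra.
    apply hm2; intros r [x ->].
    destruct (Rlt_le_dec (J x) (- m + e)) as [h|h]; [|lra].
    now destruct hn; exists x. }
  set (F := fun P : H -> Prop =>
    exists e, 0 < e /\ forall x, J x < - m + e -> P x).
  assert (FF : ProperFilter F).
  { apply Build_ProperFilter.
    - intros P (e & he & h); destruct (happ e he) as [x hx]; exists x; auto.
    - apply Build_Filter.
      + exists 1; split; [lra|trivial].
      + intros P Q (e1 & he1 & h1) (e2 & he2 & h2).
        exists (Rmin e1 e2); split; [now apply Rmin_glb_lt|].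
        intros x hx; pose proof (Rmin_l e1 e2); pose proof (Rmin_r e1 e2).
        split; [apply h1|apply h2]; lra.
      + intros P Q hPQ (e & he & h); exists e; split; auto. }
  assert (CF : cauchy F).
  { intros eps; pose proof (cond_pos eps) as heps.
    set (e := c * eps ^ 2 / 8).
    assert (he : 0 < e).
    { unfold e; apply Rdiv_lt_0_compat; [|lra].
      apply Rmult_lt_0_compat; [exact hc|now apply pow_lt]. }
    destruct (happ e he) as [x hx].
    exists x, e; split; [exact he|intros y hy].
    apply (@norm_compat1 C_AbsRing H).
    (* The midpoint cannot lie below the infimum, so convexity of [J] forces
       [c * norm (y - x) ^ 2 <= 4 * e]. *)
    pose proof (hlow (scal (RtoC (1 / 2)) (plus x y))) as hmid.
    pose proof (hT (minus y x)) as hd.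
    unfold J in hx, hy, hmid; rewrite fs, fp in hmid.
    autorewrite with re_inner in hmid, hd.
    rewrite (hs y x), (re_inner_sym y (T x)) in hmid, hd.
    set (N := norm (minus y x)) in *.
    assert (0 <= N) by apply norm_ge_0.
    assert (c * N ^ 2 <= c * (eps ^ 2 / 2)).
    { unfold e in *; lra. }
    assert (N ^ 2 <= eps ^ 2 / 2) by (now apply Rmult_le_reg_l with c).
    destruct (Rlt_le_dec N eps) as [h|h]; [exact h|nra]. }
  set (x0 := lim F : H).
  assert (hlim : forall d, 0 < d -> F (fun y => norm (minus y x0) < d)).
  { intros d hd; pose proof (@norm_factor_gt_0 C_AbsRing H) as nf.
    assert (hd' : 0 < d / @norm_factor C_AbsRing H) by now apply Rdiv_lt_0_compat.
    pose proof (complete_cauchy F FF CF (mkposreal _ hd')) as h.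
    apply filter_imp with (2 := h); intros y hy.
    apply (@norm_compat2 C_AbsRing H) in hy; simpl in hy.
    replace d with (@norm_factor C_AbsRing H * (d / @norm_factor C_AbsRing H))
      by (field; lra).
    exact hy. }
  exists x0; intros z.
  set (g := re_inner (T x0) z - f z).
  destruct (Req_dec g 0) as [h|hg]; [unfold g in h; lra|exfalso].
  assert (hg' : 0 < Rabs g) by now apply Rabs_pos_lt.
  set (q := re_inner (T z) z).
  assert (hq : 0 <= q).
  { apply Rle_trans with (2 := hT z).
    apply Rmult_le_pos; [lra|apply pow2_ge_0]. }
  pose proof (norm_ge_0 (T z)) as hTz.
  (* With this [e] the first variation [d] at an almost minimizer satisfies
     [d ^ 2 <= g ^ 2 / 8], while closeness to [x0] gives [|d - g| <= |g| / 4]: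
     together impossible. *)
  set (e := g ^ 2 / (8 * (q + 1))).
  assert (hg2 : 0 < g ^ 2) by (rewrite <- Rsqr_pow2; now apply Rsqr_pos_lt).
  assert (he : 0 < e) by (apply Rdiv_lt_0_compat; lra).
  assert (hd : 0 < Rabs g / (4 * (norm (T z) + 1))) by (apply Rdiv_lt_0_compat; lra).
  assert (hF : F (fun y => J y < - m + e)) by (exists e; auto).
  destruct (filter_ex _ (filter_and _ _ hF (hlim _ hd))) as (y & h1 & h2).
  set (d := re_inner (T y) z - f z).
  assert (hd2 : d ^ 2 <= e * q).
  { apply sqr_le_of_quadratic_ge_0; intros s.
    pose proof (hlow (plus y (scal (RtoC s) z))) as h.
    unfold J in h, h1; rewrite fp, fs in h.
    autorewrite with re_inner in h.
    rewrite (hs z y), (re_inner_sym z (T y)) in h.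
    unfold d, q; lra. }
  assert (heq : e * q <= g ^ 2 / 8).
  { replace (g ^ 2 / 8) with (e * (q + 1)) by (unfold e; field; lra).
    apply Rmult_le_compat_l; lra. }
  assert (hgd : Rabs (d - g) <= Rabs g / 4).
  { replace (d - g) with (re_inner (minus y x0) (T z)).
    2:{ unfold d, g; autorewrite with re_inner; rewrite !hs; ring. }
    apply Rle_trans with (1 := re_inner_le_norm _ _).
    apply Rle_trans with (Rabs g / (4 * (norm (T z) + 1)) * (norm (T z) + 1)).
    - apply Rmult_le_compat; try lra; apply norm_ge_0.
    - right; field; lra. }
  revert hgd; unfold Rabs; destruct (Rcase_abs (d - g)), (Rcase_abs g); intros; nra.
Qed.

End Variational.

(** * Adjoints *)

Section Adjoints.

Context {H : HilbertSpace}.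

Lemma im_inner (x y : H) : Im (inner x y) = re_inner x (scal Ci y).
Proof.
  unfold re_inner; rewrite (inner_conj _ (scal Ci y) x), inner_scal_l, (inner_conj _ x y).
  unfold Im, Re, Cmult, Cconj, Ci; simpl; ring.
Qed.

Lemma inner_of_re_inner (x y u v : H) :
  re_inner x y = re_inner u v ->
  re_inner x (scal Ci y) = re_inner u (scal Ci v) -> inner x y = inner u v.
Proof.
  rewrite <- !im_inner; unfold re_inner.
  destruct (inner x y), (inner u v); simpl; congruence.
Qed.

Lemma is_adjoint_re_inner (A A' : BOp H) :
  is_adjoint A A' <-> forall x y : H, re_inner (A x) y = re_inner x (A' y).
Proof.
  split; intros h x y.
  - unfold re_inner; now rewrite h.
  - apply inner_of_re_inner; [apply h|].
    rewrite <- bop_linear_scal; apply h.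
Qed.

(** Riesz representation of [z |-> <y, A z>] for each [y]; the estimate on
    its norm makes the representing vector depend boundedly on [y]. *)
Lemma adjoint_correct (A : BOp H) : is_adjoint A (adjoint A).
Proof.
  unfold adjoint; apply epsilon_spec.
  assert (hex : forall y : H, exists w : H,
    forall z : H, re_inner w z = re_inner y (A z)).
  { intros y.
    apply (variational_solution bop_one 1 (fun z => re_inner y (A z))
             (norm y * bop_norm A)).
    - intros u v; reflexivity.
    - split; [lra|intros z; simpl; rewrite re_inner_self; lra].
    - intros u v; now autorewrite with re_inner.
    - intros k u; now autorewrite with re_inner.
    - intros z; apply Rle_trans with (1 := re_inner_le_norm _ _).
      rewrite Rmult_assoc; apply Rmult_le_compat_l; [apply norm_ge_0|].
      apply norm_bop_le. }
  set (g := fun y => proj1_sig (constructive_indefinite_description _ (hex y))).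
  assert (hg : forall y z : H, re_inner (g y) z = re_inner y (A z)).
  { intros y; exact (proj2_sig (constructive_indefinite_description _ (hex y))). }
  assert (hgc : forall y z : H, inner (g y) z = inner y (A z)).
  { intros y z; apply inner_of_re_inner; [apply hg|].
    rewrite <- bop_linear_scal; apply hg. }
  assert (lin : is_linear g).
  { apply Build_is_linear.
    - intros x y; change (g (plus (x : H) (y : H)) = plus (g x) (g y)).
      apply re_inner_ext; intros z.
      now rewrite re_inner_plus_l, !hg, re_inner_plus_l.
    - intros k x; change (g (scal k (x : H)) = scal k (g x)).
      apply re_inner_ext; intros z; unfold re_inner.
      now rewrite inner_scal_l, !hgc, inner_scal_l.
    - exists (bop_norm A + 1); pose proof (proj1 (bop_norm_lub H A)) as hA.
      split; [lra|intros y].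
      pose proof (re_inner_self (g y)) as h1; rewrite hg in h1.
      pose proof (re_inner_le_norm y (A (g y))) as h2.
      pose proof (Rle_abs (re_inner y (A (g y)))) as h3.
      pose proof (norm_bop_le H A (g y)) as h4.
      pose proof (norm_ge_0 y) as h5; pose proof (norm_ge_0 (g y)) as h6.
      assert (norm (g y) * norm (g y) <= norm y * bop_norm A * norm (g y)) by nra.
      assert (0 <= norm y * bop_norm A) by now apply Rmult_le_pos.
      destruct h6 as [h6|h6]; [|rewrite <- h6; nra].
      assert (norm (g y) <= norm y * bop_norm A) by (now apply Rmult_le_reg_r with (norm (g y))).
      lra. }
  exists (mkBOp g lin); apply is_adjoint_re_inner; intros x y; simpl.
  now rewrite (re_inner_sym x), hg, re_inner_sym.
Qed.

Lemma re_inner_adjoint_r (A : BOp H) (x y : H) :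
  re_inner x (adjoint A y) = re_inner (A x) y.
Proof. symmetry; now apply is_adjoint_re_inner, adjoint_correct. Qed.

Lemma re_inner_adjoint_l (A : BOp H) (x y : H) :
  re_inner (adjoint A x) y = re_inner x (A y).
Proof. rewrite re_inner_sym, re_inner_adjoint_r; apply re_inner_sym. Qed.

Lemma self_adjoint_symmetric (T : BOp H) : self_adjoint T <-> symmetric T.
Proof.
  split; intros h.
  - intros x y; now rewrite <- (re_inner_adjoint_r T), h.
  - apply bop_ext; intros x; apply re_inner_ext; intros y.
    now rewrite re_inner_adjoint_l, h.
Qed.

Lemma re_inner_real_part (A : BOp H) (x y : H) :
  re_inner (real_part A x) y = (re_inner (A x) y + re_inner x (A y)) / 2.
Proof.
  unfold real_part; rewrite bop_scalE, bop_plusE; autorewrite with re_inner.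
  rewrite re_inner_adjoint_l; field.
Qed.

Lemma re_inner_real_part_self (A : BOp H) (x : H) :
  re_inner (real_part A x) x = re_inner (A x) x.
Proof. rewrite re_inner_real_part, (re_inner_sym x); field. Qed.

Lemma symmetric_real_part (A : BOp H) : symmetric (real_part A).
Proof.
  intros x y; rewrite (re_inner_sym x), !re_inner_real_part.
  rewrite (re_inner_sym (A y)), (re_inner_sym (A x)); field.
Qed.

End Adjoints.

(** * Inverses of coercive operators *)

Section Inverses.

Context {H : HilbertSpace}.

Lemma norm_ge_of_coercive (c : R) (T : BOp H) (x : H) :
  coercive c T -> c * norm x <= norm (T x).
Proof.
  intros [hc h].
  pose proof (h x) as h1; pose proof (re_inner_le_norm (T x) x) as h2.
  pose proof (Rle_abs (re_inner (T x) x)) as h3.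
  pose proof (norm_ge_0 (T x)) as h4.
  destruct (norm_ge_0 x) as [h5|h5]; [|rewrite <- h5; lra].
  apply Rmult_le_reg_r with (norm x); [exact h5|nra].
Qed.

Lemma coercive_injective (c : R) (T : BOp H) (x y : H) :
  coercive c T -> T x = T y -> x = y.
Proof.
  intros hT E; pose proof (proj1 hT) as hc.
  apply eq_of_norm_minus_lt; intros d hd.
  pose proof (proj2 hT (minus x y)) as h.
  rewrite bop_linear_minus, re_inner_minus_l, E, Rminus_diag in h.
  set (N := norm (minus x y)) in *.
  destruct (Rlt_le_dec N d) as [hN|hN]; [exact hN|].
  assert (0 < c * N ^ 2); [|lra].
  apply Rmult_lt_0_compat; [exact hc|apply pow_lt; lra].
Qed.

Lemma coercive_adjoint (c : R) (T : BOp H) :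
  coercive c T -> coercive c (adjoint T).
Proof.
  intros [hc h]; split; [exact hc|intros x].
  rewrite re_inner_adjoint_l, re_inner_sym; apply h.
Qed.

(** The lower bound [c * norm x <= norm (T* x)] makes the symmetric operator
    [T T*] coercive, and a solution [x] of [T T* x = y] yields the preimage
    [T* x] of [y] under [T]. *)
Lemma coercive_surjective (c : R) (T : BOp H) (y : H) :
  coercive c T -> exists x : H, T x = y.
Proof.
  intros hT; pose proof (proj1 hT) as hc.
  destruct (variational_solution (bop_comp T (adjoint T)) (c ^ 2) (re_inner y) (norm y))
    as [x hx].
  - intros u v; simpl.
    now rewrite <- re_inner_adjoint_r, <- (re_inner_adjoint_l T).
  - split; [now apply pow_lt|intros x].
    change (c ^ 2 * norm x ^ 2 <= re_inner (T (adjoint T x)) x).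
    rewrite <- re_inner_adjoint_r, re_inner_self, <- Rpow_mult_distr.
    apply pow_incr; split.
    + apply Rmult_le_pos; [lra|apply norm_ge_0].
    + apply norm_ge_of_coercive; now apply coercive_adjoint.
  - apply re_inner_plus_r.
  - intros; apply re_inner_scal_r.
  - apply re_inner_le_norm.
  - exists (adjoint T x); now apply re_inner_ext.
Qed.

Lemma coercive_invertible (c : R) (T : BOp H) : coercive c T -> invertible T.
Proof.
  intros hT; pose proof (proj1 hT) as hc.
  set (g := fun y => proj1_sig (constructive_indefinite_description _
                       (coercive_surjective c T y hT))).
  assert (hg : forall y, T (g y) = y).
  { intros y; exact (proj2_sig (constructive_indefinite_description _
                       (coercive_surjective c T y hT))). }
  assert (lin : is_linear g).
  { apply Build_is_linear.
    - intros x y; change (g (plus (x : H) (y : H)) = plus (g x) (g y)).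
      apply (coercive_injective c T); [exact hT|].
      now rewrite bop_linear_plus, !hg.
    - intros k x; change (g (scal k (x : H)) = scal k (g x)).
      apply (coercive_injective c T); [exact hT|].
      now rewrite bop_linear_scal, !hg.
    - exists (/ c); split; [now apply Rinv_0_lt_compat|intros y].
      pose proof (norm_ge_of_coercive c T (g y) hT) as h; rewrite hg in h.
      apply Rmult_le_reg_l with c; [exact hc|].
      rewrite <- Rmult_assoc, Rinv_r, Rmult_1_l; [exact h|lra]. }
  exists (mkBOp g lin); split; apply bop_ext; intros x; simpl.
  - apply hg.
  - apply (coercive_injective c T); [exact hT|apply hg].
Qed.

Lemma bop_inv_r (T : BOp H) (x : H) : invertible T -> T (bop_inv T x) = x.
Proof.
  intros h; destruct (epsilon_spec (inhabits zero) (is_inverse T) h) as [E _].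
  exact (f_equal (fun S : BOp H => S x) E).
Qed.

Lemma bop_inv_l (T : BOp H) (x : H) : invertible T -> bop_inv T (T x) = x.
Proof.
  intros h; destruct (epsilon_spec (inhabits zero) (is_inverse T) h) as [_ E].
  exact (f_equal (fun S : BOp H => S x) E).
Qed.

Lemma norm_bop_inv_le (c : R) (T : BOp H) (x : H) :
  coercive c T -> norm (bop_inv T x) <= norm x / c.
Proof.
  intros hT; pose proof (proj1 hT) as hc.
  pose proof (norm_ge_of_coercive c T (bop_inv T x) hT) as h.
  rewrite bop_inv_r in h by now apply coercive_invertible with c.
  apply Rmult_le_reg_l with c; [exact hc|].
  replace (c * (norm x / c)) with (norm x) by (field; lra); exact h.
Qed.

Lemma symmetric_bop_inv (T : BOp H) :
  invertible T -> symmetric T -> symmetric (bop_inv T).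
Proof.
  intros hi hs x y.
  rewrite <- (bop_inv_r T y hi) at 1.
  now rewrite <- hs, bop_inv_r.
Qed.

(** Cauchy-Schwarz for the form [<T x, y>] at [y = T^-1 x] reads
    [norm x ^ 4 <= <T x, x> <x, T^-1 x>], and the last factor is at most
    [bop_norm (T^-1) * norm x ^ 2]. *)
Lemma strictly_positive_coercive (T : BOp H) :
  strictly_positive T -> exists c, coercive c T.
Proof.
  intros [[hs hp] hi]; apply self_adjoint_symmetric in hs.
  pose proof (proj1 (bop_norm_lub H (bop_inv T))) as hK.
  (* Adding 1 keeps [K] positive even when [H] is the zero space. *)
  set (K := bop_norm (bop_inv T) + 1).
  assert (K0 : 0 < K) by (unfold K; lra).
  exists (/ K); split; [now apply Rinv_0_lt_compat|intros x].
  pose proof (symmetric_cauchy_schwarz T x (bop_inv T x) hs hp) as h1.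
  rewrite hs, bop_inv_r, re_inner_self in h1 by exact hi.
  pose proof (re_inner_le_norm x (bop_inv T x)) as h2.
  pose proof (Rle_abs (re_inner x (bop_inv T x))) as h3.
  pose proof (norm_bop_le H (bop_inv T) x) as h4.
  pose proof (norm_ge_0 x) as h5.
  assert (h6 : re_inner x (bop_inv T x) <= K * norm x ^ 2) by (unfold K; nra).
  specialize (hp x); fold (re_inner (T x) x) in hp.
  rewrite (hs x x).
  rewrite hs in h1, hp.
  destruct h5 as [h5|h5]; [|rewrite <- h5; lra].
  assert (hn : 0 < norm x ^ 2) by now apply pow_lt.
  assert (norm x ^ 2 <= K * re_inner x (T x)).
  { apply Rmult_le_reg_r with (norm x ^ 2); [exact hn|nra]. }
  apply Rmult_le_reg_l with K; [exact K0|].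
  rewrite <- Rmult_assoc, Rinv_r, Rmult_1_l; lra.
Qed.

Lemma coercive_real_part (c : R) (A : BOp H) :
  coercive c (real_part A) <-> coercive c A.
Proof.
  unfold coercive; split; intros [hc h]; split; trivial; intros x;
    specialize (h x); rewrite re_inner_real_part_self in *; exact h.
Qed.

(** With [y = T^-1 u] one has [<T^-1 u, u> = <y, T y> >= c * norm y ^ 2], and
    [norm u <= bop_norm T * norm y]. *)
Lemma coercive_bop_inv (c : R) (T : BOp H) :
  coercive c T -> exists d, coercive d (bop_inv T).
Proof.
  intros hT; pose proof (proj1 hT) as hc.
  pose proof (coercive_invertible c T hT) as hi.
  pose proof (proj1 (bop_norm_lub H T)) as hN0.
  set (N := bop_norm T + 1).
  assert (hN : 0 < N) by (unfold N; lra).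
  exists (c / N ^ 2); split.
  { apply Rdiv_lt_0_compat; [exact hc|now apply pow_lt]. }
  intros u; set (y := bop_inv T u).
  assert (hu : T y = u) by now apply bop_inv_r.
  pose proof (norm_bop_le H T y) as h1; rewrite hu in h1.
  pose proof (norm_ge_0 y) as h2; pose proof (norm_ge_0 u) as h3.
  pose proof (proj2 hT y) as h4; rewrite hu, re_inner_sym in h4.
  apply Rle_trans with (2 := h4).
  replace (c / N ^ 2 * norm u ^ 2) with (c * (norm u / N) ^ 2) by (field; lra).
  apply Rmult_le_compat_l; [lra|apply pow_incr; split].
  - now apply Rdiv_le_0_compat.
  - apply Rmult_le_reg_r with N; [exact hN|].
    replace (norm u / N * N) with (norm u) by (field; lra); unfold N; nra.
Qed.

Lemma coercive_convex (a b t : R) (S T : BOp H) :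
  coercive a S -> coercive b T -> 0 <= t <= 1 ->
  coercive (Rmin a b) (plus (scal (1 - t) S) (scal t T)).
Proof.
  intros [ha hS] [hb hT] ht; split; [now apply Rmin_glb_lt|intros x].
  rewrite bop_plusE, !bop_scalE; autorewrite with re_inner.
  specialize (hS x); specialize (hT x).
  pose proof (Rmin_l a b); pose proof (Rmin_r a b).
  pose proof (pow2_ge_0 (norm x)).
  assert (Rmin a b * norm x ^ 2 <= re_inner (S x) x) by nra.
  assert (Rmin a b * norm x ^ 2 <= re_inner (T x) x) by nra.
  nra.
Qed.

End Inverses.

(** * Weighted harmonic means *)

Section HarmonicMeans.

Context {H : HilbertSpace}.

Definition inverse_mean (t : R) (A B : BOp H) : BOp H :=
  plus (scal (1 - t) (bop_inv A)) (scal t (bop_inv B)).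

Lemma inverse_mean_vec (t : R) (A B : BOp H) (x : H) :
  inverse_mean t A B x =
  plus (scal (RtoC (1 - t)) (bop_inv A x)) (scal (RtoC t) (bop_inv B x)).
Proof. reflexivity. Qed.

Lemma coercive_inverse_mean (a b : R) (A B : BOp H) :
  coercive a A -> coercive b B ->
  exists c, forall t, 0 <= t <= 1 -> coercive c (inverse_mean t A B).
Proof.
  intros hA hB.
  destruct (coercive_bop_inv a A hA) as [a' hA'].
  destruct (coercive_bop_inv b B hB) as [b' hB'].
  exists (Rmin a' b'); intros t ht; now apply coercive_convex.
Qed.

(** The harmonic mean solves a splitting problem: [x] decomposes as
    [(1 - t) y + t z] with [A y = B z = v], and pairing [v] with this
    decomposition turns its quadratic form into the energy of the pair
    [(y, z)].  Only real parts of [A] and [B] enter that energy. *)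
Lemma harmonic_mean_form (a b t : R) (A B : BOp H) (x : H) :
  coercive a A -> coercive b B -> 0 <= t <= 1 ->
  let v := harmonic_mean t A B x in
  let y := bop_inv A v in
  let z := bop_inv B v in
  x = plus (scal (RtoC (1 - t)) y) (scal (RtoC t) z) /\
  re_inner v x = (1 - t) * re_inner (A y) y + t * re_inner (B z) z.
Proof.
  intros hA hB ht v y z.
  assert (hx : x = plus (scal (RtoC (1 - t)) y) (scal (RtoC t) z)).
  { destruct (coercive_inverse_mean a b A B hA hB) as [c hc].
    symmetry; apply (bop_inv_r (inverse_mean t A B)).
    now apply coercive_invertible with c, hc. }
  split; [exact hx|].
  rewrite hx; autorewrite with re_inner; unfold y, z.
  rewrite !bop_inv_r; [ring| |]; eapply coercive_invertible; eassumption.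
Qed.

(** For symmetric operators the energy is convex and its critical point among
    all splittings of [x] is the one produced by the harmonic mean, where
    [P y] and [Q z] are the same vector [v]. *)
Lemma harmonic_mean_minimal (p q t : R) (P Q : BOp H) (y z : H) :
  symmetric P -> symmetric Q -> coercive p P -> coercive q Q -> 0 <= t <= 1 ->
  let x := plus (scal (RtoC (1 - t)) y) (scal (RtoC t) z) in
  re_inner (harmonic_mean t P Q x) x
  <= (1 - t) * re_inner (P y) y + t * re_inner (Q z) z.
Proof.
  intros sP sQ hP hQ ht x.
  destruct (harmonic_mean_form p q t P Q x hP hQ ht) as [_ hv].
  set (v := harmonic_mean t P Q x) in *.
  set (y0 := bop_inv P v) in *; set (z0 := bop_inv Q v) in *.
  assert (hy : P y0 = v) by (apply bop_inv_r; eapply coercive_invertible; eassumption).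
  assert (hz : Q z0 = v) by (apply bop_inv_r; eapply coercive_invertible; eassumption).
  assert (hv' : re_inner v x = (1 - t) * re_inner (P y0) y + t * re_inner (Q z0) z).
  { unfold x; autorewrite with re_inner; now rewrite hy, hz. }
  (* Convexity: [<T (u - w), u - w>] is nonnegative. *)
  assert (square : forall c (T : BOp H) (u w : H), symmetric T -> coercive c T ->
    2 * re_inner (T u) w <= re_inner (T u) u + re_inner (T w) w).
  { intros c T u w sT [hc hT].
    pose proof (hT (minus u w)) as h.
    autorewrite with re_inner in h.
    rewrite (sT w u), (re_inner_sym w (T u)) in h.
    pose proof (Rmult_le_pos _ _ (Rlt_le _ _ hc) (pow2_ge_0 (norm (minus u w)))).
    lra. }
  pose proof (square p P y0 y sP hP) as h1; pose proof (square q Q z0 z sQ hQ) as h2.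
  nra.
Qed.

(** The splitting of [x] that comes from [A] and [B] has energy
    [<(A !_t B) x, x>] and is a competitor in the minimization that
    characterizes the harmonic mean of the real parts. *)
Lemma re_inner_harmonic_mean_ge (a b t : R) (A B : BOp H) (x : H) :
  coercive a A -> coercive b B -> 0 <= t <= 1 ->
  re_inner (harmonic_mean t (real_part A) (real_part B) x) x
  <= re_inner (harmonic_mean t A B x) x.
Proof.
  intros hA hB ht.
  destruct (harmonic_mean_form a b t A B x hA hB ht) as [hx ->].
  rewrite <- (re_inner_real_part_self A), <- (re_inner_real_part_self B).
  rewrite hx at 1 2.
  apply (harmonic_mean_minimal a b); trivial;
    try apply symmetric_real_part; now apply coercive_real_part.
Qed.

Lemma symmetric_harmonic_mean (p q t : R) (P Q : BOp H) :
  symmetric P -> symmetric Q -> coercive p P -> coercive q Q -> 0 <= t <= 1 ->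
  symmetric (harmonic_mean t P Q).
Proof.
  intros sP sQ hP hQ ht.
  destruct (coercive_inverse_mean p q P Q hP hQ) as [c hc].
  apply symmetric_bop_inv.
  - eapply coercive_invertible; exact (hc t ht).
  - apply coercive_invertible in hP; apply coercive_invertible in hQ.
    intros x y; fold (inverse_mean t P Q).
    rewrite !inverse_mean_vec; autorewrite with re_inner.
    now rewrite (symmetric_bop_inv P hP sP x y), (symmetric_bop_inv Q hQ sQ x y).
Qed.

End HarmonicMeans.

(** * The integrand of the entropy *)

Section Integrand.

Context {H : HilbertSpace}.

Definition entropy_integrand (A B : BOp H) (t : R) : BOp H :=
  scal (/ t) (minus (harmonic_mean t A B) A).

Lemma re_inner_entropy_integrand (A B : BOp H) (t : R) (x y : H) :
  re_inner (entropy_integrand A B t x) y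
  = / t * (re_inner (harmonic_mean t A B x) y - re_inner (A x) y).
Proof.
  unfold entropy_integrand; rewrite bop_scalE, bop_minusE.
  now autorewrite with re_inner.
Qed.

(** The continuous extension to [t = 0] of the integrand: with
    [M = (1 - t) A^-1 + t B^-1] one has
    [M^-1 - A = - t M^-1 (B^-1 - A^-1) A], so the factor [1 / t] cancels. *)
Definition regular_integrand (A B : BOp H) (t : R) : BOp H :=
  opp (bop_comp (harmonic_mean t A B)
         (bop_comp (minus (bop_inv B) (bop_inv A)) A)).

Lemma entropy_integrand_regular (a b t : R) (A B : BOp H) :
  coercive a A -> coercive b B -> 0 < t <= 1 ->
  regular_integrand A B t = entropy_integrand A B t.
Proof.
  intros hA hB ht; apply bop_ext; intros x; apply re_inner_ext; intros z.
  rewrite re_inner_entropy_integrand.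
  set (X := harmonic_mean t A B).
  set (d := bop_inv B (A x)).
  transitivity (- re_inner (X (minus d (bop_inv A (A x)))) z).
  { apply re_inner_opp_l. }
  destruct (coercive_inverse_mean a b A B hA hB) as [c hc].
  assert (hX : X (inverse_mean t A B (A x)) = A x).
  { apply (bop_inv_l (inverse_mean t A B)).
    apply coercive_invertible with c, hc; lra. }
  rewrite inverse_mean_vec in hX; fold d in hX.
  rewrite bop_inv_l in * by (eapply coercive_invertible; eassumption).
  rewrite <- hX at 1; autorewrite with re_inner; field; lra.
Qed.

(** The resolvent identity: if [u] and [v] are the values at [x] for the
    parameters [t] and [s], then [M_t (u - v) = (s - t) (B^-1 - A^-1) v], and
    the coercivity constant of [M_t] can be chosen independent of [t]. *)
Lemma harmonic_mean_lipschitz (a b : R) (A B : BOp H) :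
  coercive a A -> coercive b B ->
  exists K, forall s t, 0 <= s <= 1 -> 0 <= t <= 1 -> forall x : H,
    norm (minus (harmonic_mean t A B x) (harmonic_mean s A B x))
    <= K * Rabs (t - s) * norm x.
Proof.
  intros hA hB.
  destruct (coercive_inverse_mean a b A B hA hB) as [c hc].
  set (D := minus (bop_inv B) (bop_inv A)).
  exists (bop_norm D / c ^ 2); intros s t hs ht x.
  pose proof (hc s hs) as hMs; pose proof (hc t ht) as hMt.
  pose proof (proj1 hMs) as c0.
  set (u := harmonic_mean t A B x); set (v := harmonic_mean s A B x).
  assert (hu : inverse_mean t A B u = x).
  { apply bop_inv_r; eapply coercive_invertible; exact hMt. }
  assert (hv : inverse_mean s A B v = x).
  { apply bop_inv_r; eapply coercive_invertible; exact hMs. }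
  assert (E : inverse_mean t A B (minus u v) = scal (RtoC (s - t)) (D v)).
  { rewrite bop_linear_minus, hu, <- hv.
    apply re_inner_ext; intros z.
    unfold D; rewrite bop_minusE, !inverse_mean_vec; autorewrite with re_inner; ring. }
  pose proof (norm_ge_of_coercive c _ (minus u v) hMt) as h1.
  rewrite E in h1.
  pose proof (hnorm_scal (RtoC (s - t)) (D v)) as h2.
  rewrite Cmod_R, Rabs_minus_sym in h2.
  pose proof (norm_bop_le H D v) as h3.
  pose proof (norm_bop_inv_le c _ x hMs) as h4; change (norm v <= norm x / c) in h4.
  apply Rmult_le_reg_l with c; [exact c0|].
  apply Rle_trans with (1 := h1); apply Rle_trans with (1 := h2).
  apply Rle_trans with (Rabs (t - s) * (bop_norm D * (norm x / c))).
  - apply Rmult_le_compat_l; [apply Rabs_pos|].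
    apply Rle_trans with (1 := h3).
    apply Rmult_le_compat_l; [exact (proj1 (bop_norm_lub H D))|exact h4].
  - right; field; lra.
Qed.

Lemma regular_integrand_lipschitz (a b : R) (A B : BOp H) :
  coercive a A -> coercive b B ->
  exists K, forall s t, 0 <= s <= 1 -> 0 <= t <= 1 ->
    norm (minus (regular_integrand A B t) (regular_integrand A B s))
    <= K * Rabs (t - s).
Proof.
  intros hA hB.
  destruct (harmonic_mean_lipschitz a b A B hA hB) as [K hK].
  set (S := bop_comp (minus (bop_inv B) (bop_inv A)) A).
  pose proof (proj1 (bop_norm_lub H S)) as hS.
  exists (Rabs K * bop_norm S); intros s t hs ht.
  pose proof (Rabs_pos K) as K0; pose proof (Rabs_pos (t - s)) as ts0.
  apply bop_norm_le.
  { apply Rmult_le_pos; [now apply Rmult_le_pos|exact ts0]. }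
  intros x.
  replace (minus (regular_integrand A B t) (regular_integrand A B s) x)
    with (opp (minus (harmonic_mean t A B (S x)) (harmonic_mean s A B (S x)) : H) : H).
  2:{ apply re_inner_ext; intros z.
      rewrite bop_minusE.
      change (re_inner (opp (minus (harmonic_mean t A B (S x)) (harmonic_mean s A B (S x)) : H) : H) z =
        re_inner (minus (opp (harmonic_mean t A B (S x)) : H) (opp (harmonic_mean s A B (S x)) : H)) z).
      rewrite re_inner_opp_l, !re_inner_minus_l, !re_inner_opp_l; ring. }
  rewrite hnorm_opp.
  apply Rle_trans with (1 := hK s t hs ht (S x)).
  pose proof (norm_bop_le H S x) as h1; pose proof (Rle_abs K) as h2.
  pose proof (norm_ge_0 (S x)) as h3.
  apply Rle_trans with (Rabs K * Rabs (t - s) * norm (S x)).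
  - apply Rmult_le_compat_r; [exact h3|now apply Rmult_le_compat_r].
  - apply Rle_trans with (Rabs K * Rabs (t - s) * (bop_norm S * norm x)).
    + apply Rmult_le_compat_l; [now apply Rmult_le_pos|exact h1].
    + right; ring.
Qed.

End Integrand.

(** * Integration *)

(** Composing with the projection of the line onto [[a, b]] makes the function
    continuous at the endpoints from both sides. *)
Lemma ex_RInt_lipschitz {V : CompleteNormedModule R_AbsRing} (g : R -> V) (a b K : R) :
  a <= b ->
  (forall s t, a <= s <= b -> a <= t <= b ->
     norm (minus (g t) (g s)) <= K * Rabs (t - s)) ->
  ex_RInt g a b.
Proof.
  intros hab hg.
  set (clamp := fun t => Rmax a (Rmin b t)).
  assert (hc : forall t, a <= clamp t <= b).
  { intros t; unfold clamp, Rmax, Rmin.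
    repeat destruct Rle_dec; lra. }
  assert (hl : forall s t, Rabs (clamp t - clamp s) <= Rabs (t - s)).
  { intros s t; unfold clamp, Rmax, Rmin, Rabs.
    repeat (destruct Rle_dec || destruct Rcase_abs); lra. }
  apply (ex_RInt_ext (fun t => g (clamp t))).
  { intros t; rewrite Rmin_left, Rmax_right by lra; intros ht.
    f_equal; unfold clamp; rewrite Rmin_right, Rmax_right; lra. }
  apply (ex_RInt_continuous (V := V)); intros s _.
  apply filterlim_locally; intros eps; pose proof (cond_pos eps) as he.
  pose proof (Rabs_pos K) as K0.
  assert (hd : 0 < eps / (Rabs K + 1)) by (apply Rdiv_lt_0_compat; lra).
  exists (mkposreal _ hd); intros t ht.
  apply (@norm_compat1 R_AbsRing V).
  change (Rabs (t - s) < eps / (Rabs K + 1)) in ht.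
  pose proof (Rabs_pos (t - s)) as ts0.
  apply Rle_lt_trans with (1 := hg _ _ (hc s) (hc t)).
  apply Rle_lt_trans with ((Rabs K + 1) * Rabs (t - s)).
  - pose proof (hl s t); pose proof (Rabs_pos (clamp t - clamp s)).
    pose proof (Rle_abs K); nra.
  - replace (pos eps) with ((Rabs K + 1) * (eps / (Rabs K + 1))) by (field; lra).
    apply Rmult_lt_compat_l; lra.
Qed.

Lemma is_RInt_linear {U V : NormedModule R_AbsRing} (l : U -> V) (f : R -> U)
    (a b : R) (I : U) :
  is_linear l -> is_RInt f a b I -> is_RInt (fun t => l (f t)) a b (l I).
Proof.
  intros hl hf; unfold is_RInt.
  assert (hsum : forall ptd, Riemann_sum (fun t => l (f t)) ptd = l (Riemann_sum f ptd)).
  { intros ptd; apply SF_cons_ind with (s := ptd).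
    - intros x; unfold Riemann_sum; simpl; symmetry; apply (linear_zero l hl).
    - intros h s IH; rewrite !Riemann_sum_cons, IH.
      now rewrite (linear_plus l hl), (linear_scal l hl). }
  apply filterlim_ext with
    (fun ptd => l (scal (sign (b - a)) (Riemann_sum f ptd))).
  { intros ptd; now rewrite hsum, (linear_scal l hl). }
  eapply filterlim_comp; [exact hf|].
  now apply (linear_cont l).
Qed.

Section Entropy.

Context {H : HilbertSpace}.

Lemma is_linear_re_inner (x y : H) :
  @is_linear R_AbsRing (BOp_NormedModule H) R_NormedModule
    (fun T : BOp H => re_inner (T x) y).
Proof.
  apply Build_is_linear.
  - intros S T; apply re_inner_plus_l.
  - intros k T; apply re_inner_scal_l.
  - exists (norm x * norm y + 1); pose proof (norm_ge_0 x) as hx.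
    pose proof (norm_ge_0 y) as hy.
    split; [nra|intros T].
    apply Rle_trans with (1 := re_inner_le_norm (T x) y).
    pose proof (norm_bop_le H T x) as h.
    pose proof (proj1 (bop_norm_lub H T)) as hT.
    change (norm (T x) * norm y <= (norm x * norm y + 1) * bop_norm T).
    apply Rle_trans with (bop_norm T * norm x * norm y); [|nra].
    now apply Rmult_le_compat_r.
Qed.

(** Matrix coefficients are bounded real-linear functionals of an operator,
    so they pass under the integral; this reduces the operator inequality to
    integrals of real functions. *)
Lemma is_RInt_re_inner_rel_entropy (a b : R) (A B : BOp H) (x y : H) :
  coercive a A -> coercive b B ->
  is_RInt (fun t => re_inner (entropy_integrand A B t x) y) 0 1
    (re_inner (rel_entropy A B x) y).
Proof.
  intros hA hB.
  apply (is_RInt_linear (U := BOp_NormedModule H) (V := R_NormedModule)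
    (fun T : BOp H => re_inner (T x) y) (entropy_integrand A B)).
  - apply is_linear_re_inner.
  - apply (RInt_correct (V := BOp_CompleteNormedModule H) (entropy_integrand A B)).
    apply ex_RInt_ext with (regular_integrand A B).
    + intros t; rewrite Rmin_left, Rmax_right by lra; intros ht.
      apply (entropy_integrand_regular a b); trivial; lra.
    + destruct (regular_integrand_lipschitz a b A B hA hB) as [K hK].
      exact (ex_RInt_lipschitz _ 0 1 K Rle_0_1 hK).
Qed.

Lemma symmetric_rel_entropy (p q : R) (P Q : BOp H) :
  symmetric P -> symmetric Q -> coercive p P -> coercive q Q ->
  symmetric (rel_entropy P Q).
Proof.
  intros sP sQ hP hQ x y; rewrite (re_inner_sym x).
  rewrite <- (is_RInt_unique _ _ _ _ (is_RInt_re_inner_rel_entropy p q P Q x y hP hQ)).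
  rewrite <- (is_RInt_unique _ _ _ _ (is_RInt_re_inner_rel_entropy p q P Q y x hP hQ)).
  apply RInt_ext; intros t; rewrite Rmin_left, Rmax_right by lra; intros ht.
  rewrite !re_inner_entropy_integrand, (re_inner_sym _ x), (re_inner_sym (P y) x).
  rewrite sP, (symmetric_harmonic_mean p q t P Q sP sQ hP hQ); [reflexivity|lra].
Qed.

End Entropy.

Theorem theorem3p2 (H : HilbertSpace) (A B : BOp H)
    (hA : accretive A) (hB : accretive B) :
  bop_ge (real_part (rel_entropy A B))
         (rel_entropy (real_part A) (real_part B)).
Proof.
  destruct (strictly_positive_coercive _ hA) as [a ha].
  destruct (strictly_positive_coercive _ hB) as [b hb].
  pose proof (proj1 (coercive_real_part a A) ha) as ha'.
  pose proof (proj1 (coercive_real_part b B) hb) as hb'.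
  split.
  - apply self_adjoint_symmetric; intros x y.
    rewrite !bop_minusE, re_inner_minus_l, re_inner_minus_r.
    rewrite symmetric_real_part.
    rewrite (symmetric_rel_entropy a b (real_part A) (real_part B)); trivial;
      apply symmetric_real_part.
  - intros x; fold (re_inner (minus (real_part (rel_entropy A B))
      (rel_entropy (real_part A) (real_part B)) x) x).
    rewrite bop_minusE, re_inner_minus_l, re_inner_real_part_self.
    apply Rge_le, Rge_minus, Rle_ge.
    apply is_RInt_le with (3 := is_RInt_re_inner_rel_entropy a b A B x x ha' hb')
      (2 := is_RInt_re_inner_rel_entropy a b _ _ x x ha hb); [lra|].
    intros t ht; rewrite !re_inner_entropy_integrand, re_inner_real_part_self.
    apply Rmult_le_compat_l; [apply Rlt_le, Rinv_0_lt_compat; lra|].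
    apply Rplus_le_compat_r, (re_inner_harmonic_mean_ge a b); trivial; lra.
Qed.
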